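(* The fractional versions of both the domination game and the total domination game have rational game values on every hypergraph. Moreover, in either of these games, both players can achieve their common optimum using only rational weights and within finitely many submoves.
   Context: A hypergraph $\mathcal{H}=(V,\mathcal{E})$ has a finite vertex set $V$ and an edge set $\mathcal{E}\subseteq 2^V\setminus\{\emptyset\}$ (graphs are $2$-uniform hypergraphs). The open neighborhood of $v\in V$ is $N(v)=\{u\in V\setminus\{v\}: u,v\in E\text{ for some }E\in\mathcal{E}\}$, and the closed neighborhood is $N[v]=N(v)\cup\{v\}$. The closed neighborhood hypergraph of $\mathcal{H}$ has vertex set $V$ and edges $N[v]$, $v\in V$; the open neighborhood hypergraph has vertex set $V$ and edges $N(v)$, $v\in V$. The fractional domination game (resp. fractional total domination game) on $\mathcal{H}$ is the fractional transversal game played on the closed (resp. open) neighborhood hypergraph of $\mathcal{H}$. Since edges of a hypergraph are always nonempty, the total version is considered only on hypergraphs in which every vertex has a nonempty open neighborhood. Fractional transversal game on a hypergraph $(V,\mathcal{F})$ with $\mathcal{F}\subseteq 2^V\setminus\{\emptyset\}$: Edge-hitter and Staller take turns making moves and update a cover function $t:V\to[0,1]$, with $|t|=\sum_{v}t(v)$. The corresponding load function is $\ell:\mathcal{F}\to[0,1]$, $\ell(F)=\min\{1,\sum_{v\in F}t(v)\}$. The functions after the $i$-th move are $t_i,\ell_i$; initially $t_0\equiv0$, $\ell_0\equiv0$. The game is finished when $\ell\equiv1$. As long as $\ell\not\equiv1$, the next player performs a move, which is a finite or infinite sequence of submoves $(u_1,w_1),(u_2,w_2),\dots$, where $u_k\in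 V$ (repetitions allowed) and the weights $w_k$ are reals in $[0,1]$. It is required that $\sum_kw_k=1$ in each move except the last move of the game, where $\sum_kw_k\le1$ suffices. The $i$-th move must be legal: for every $k\ge1$ there is an edge $F\in\mathcal{F}$ with $u_k\in F$ and $\ell_{i-1}(F)+\sum_{1\le s\le k-1,\,u_s\in F}w_s+w_k\le1$. The function $t_i$ is obtained from $t_{i-1}$ by adding $w_k$ to the value at $u_k$ for every submove. The value $|\mathcal{G}|$ of a game is $|t_q|$ for the final cover function $t_q$. Edge-hitter wants it small, Staller wants it large. The game value (for a given starting player) is the infimum of all $a$ such that Edge-hitter has a strategy ensuring $|\mathcal{G}|\le a$; it equals the supremum of all $b$ such that Staller has a strategy ensuring $|\mathcal{G}|\ge b$, and is the common optimum of the players. Edge-hitter (resp. Staller) achieves the optimum by a strategy ensuring $|\mathcal{G}|\le$ (resp. $\ge$) this value. *)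

(* Defs.v *)
(* MathComp / MathComp-Analysis; weights live in an arbitrary [R : realType].
   A hypergraph on the finite vertex set [V] is given by its edge set
   [E : {set {set V}}], subject to [set0 \notin E]. *)
From mathcomp Require Import all_boot all_order all_algebra.
From mathcomp Require Import boolp classical_sets reals ereal topology sequences.

Set Implicit Arguments.
Unset Strict Implicit.
Unset Printing Implicit Defensive.

Import Order.TTheory GRing.Theory Num.Theory.

Local Open Scope ring_scope.

Definition open_nbhd (V : finType) (E : {set {set V}}) (v : V) : {set V} :=
  finset (fun u => (u != v) && [exists F in E, (u \in F) && (v \in F)]).

Definition closed_nbhd (V : finType) (E : {set {set V}}) (v : V) : {set V} :=
  (v |: open_nbhd E v)%SET.

Definition open_nbhd_hypergraph (V : finType) (E : {set {set V}}) :
    {set {set V}} :=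
  finset (fun F => [exists v, F == open_nbhd E v]).

Definition closed_nbhd_hypergraph (V : finType) (E : {set {set V}}) :
    {set {set V}} :=
  finset (fun F => [exists v, F == closed_nbhd E v]).

(* A move is a finite or an infinite sequence of submoves (vertex, weight). *)
Inductive game_move (R : realType) (V : finType) :=
| FiniteMove of seq (V * R)
| InfiniteMove of (nat -> V * R).

Definition submove (R : realType) (V : finType) (m : game_move R V) (k : nat) :
    option (V * R) :=
  match m with
  | FiniteMove s => onth s k
  | InfiniteMove f => Some (f k)
  end.

(* [submove_weight m A k] is w_k if the k-th submove (u_k, w_k) exists and
   u_k \in A, and 0 otherwise. *)
Definition submove_weight (R : realType) (V : finType) (m : game_move R V)
    (A : {set V}) (k : nat) : R :=
  if submove m k is Some (u, w) then (if u \in A then w else 0) else 0.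

(* Extended-real valued, so that no convergence convention is involved for
   nonnegative weights. *)
Definition move_weight (R : realType) (V : finType) (m : game_move R V)
    (A : {set V}) : \bar R :=
  (\sum_(0 <= k <oo) (submove_weight m A k)%:E)%E.

(* For a legal move, [move_weight m [set v]] is finite (at most 1): each
   submove of positive weight at v fits into an edge containing v. For the same
   reason cover functions reached by legal moves have values in [0,1]. *)
Definition apply_move (R : realType) (V : finType) (t : V -> R)
    (m : game_move R V) : V -> R :=
  fun v => t v + fine (move_weight m (finset.set1 v)).

Definition load (R : realType) (V : finType) (t : V -> R) (F : {set V}) : R :=
  Num.min 1 (\sum_(v in F) t v).

Definition finished (R : realType) (V : finType) (N : {set {set V}})
    (t : V -> R) : Prop :=
  forall F, F \in N -> load t F = 1.

(* The second conjunct: the total weight is 1, except that it may be smaller in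
   the last move of the game, i.e. in a move after which every load is 1. *)
Definition legal_move (R : realType) (V : finType) (N : {set {set V}})
    (t : V -> R) (m : game_move R V) : Prop :=
  (forall k u w, submove m k = Some (u, w) ->
     0 <= w <= 1 /\
     exists F, [/\ F \in N, u \in F &
       load t F + \sum_(s < k) submove_weight m F s + w <= 1]) /\
  (move_weight m (finset.setTfor V) = 1%E \/
   (move_weight m (finset.setTfor V) <= 1)%E /\ finished N (apply_move t m)).

Inductive player := EdgeHitter | Staller.

Definition opponent (p : player) : player :=
  match p with EdgeHitter => Staller | Staller => EdgeHitter end.

Definition to_move (first : player) (i : nat) : player :=
  if odd i then opponent first else first.

(* The cover function after the moves listed (in chronological order) in h. *)
Definition cover (R : realType) (V : finType) (h : seq (game_move R V)) :
    V -> R :=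
  foldl (@apply_move R V) (fun=> 0) h.

Definition game_weight (R : realType) (V : finType)
    (h : seq (game_move R V)) : R :=
  \sum_(v : V) cover h v.

Definition strategy (R : realType) (V : finType) :=
  seq (game_move R V) -> game_move R V.

(* Histories of the game, started by [first], in which every move is legal and
   player [p] follows [sigma]. The last position may or may not be finished. *)
Inductive play_with (R : realType) (V : finType) (N : {set {set V}})
    (first p : player) (sigma : strategy R V) : seq (game_move R V) -> Prop :=
| play_start : play_with N first p sigma [::]
| play_move h m :
    play_with N first p sigma h ->
    ~ finished N (cover h) ->
    legal_move N (cover h) m ->
    (to_move first (size h) = p -> m = sigma h) ->
    play_with N first p sigma (rcons h m).

Definition legal_strategy (R : realType) (V : finType) (N : {set {set V}})
    (first p : player) (sigma : strategy R V) : Prop :=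
  forall h, play_with N first p sigma h -> ~ finished N (cover h) ->
    to_move first (size h) = p -> legal_move N (cover h) (sigma h).

(* [a] is an upper bound for Edge-hitter and a lower bound for Staller. Every
   game ends (each move but the last one has weight 1, while the cover function
   is bounded by 1), so quantifying over finished histories is enough. *)
Definition ensures (R : realType) (V : finType) (N : {set {set V}})
    (first p : player) (sigma : strategy R V) (a : R) : Prop :=
  legal_strategy N first p sigma /\
  forall h, play_with N first p sigma h -> finished N (cover h) ->
    match p with
    | EdgeHitter => game_weight h <= a
    | Staller => a <= game_weight h
    end.

Definition game_value (R : realType) (V : finType) (N : {set {set V}})
    (first : player) : R :=
  inf (fun a => exists sigma : strategy R V,
         ensures N first EdgeHitter sigma a).

Definition rational_weights (R : realType) (V : finType) (m : game_move R V) :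
    Prop :=
  forall k u w, submove m k = Some (u, w) -> exists q : rat, w = ratr q.

Definition finitely_many_submoves (R : realType) (V : finType)
    (m : game_move R V) : Prop :=
  exists s, m = FiniteMove s.

(* Whatever the opponent does, [sigma] uses finitely many submoves; its weights
   are rational at every position with rational cover function, in particular
   as long as the opponent also makes finite moves with rational weights. This
   proviso cannot be dropped: if N = {{a}, {b}} and the opponent starts with
   weights x on a and 1 - x on b, x in ]0,1[ irrational, then every legal reply
   has total weights 1 - x on a and x on b. *)
Definition finite_rational_strategy (R : realType) (V : finType)
    (N : {set {set V}}) (first p : player) (sigma : strategy R V) : Prop :=
  forall h, play_with N first p sigma h -> ~ finished N (cover h) ->
    to_move first (size h) = p ->
    finitely_many_submoves (sigma h) /\
    ((forall v, exists q : rat, cover h v = ratr q) ->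
       rational_weights (sigma h)).

(* Main.v *)
From mathcomp Require Import boolp reals ereal.
From mathcomp Require Import all_boot all_order all_algebra.
From mathcomp Require classical_sets filter topology normedtype sequences.
From mathcomp Require Import ring lra.
Require Import Defs.

(** The result holds for the fractional transversal game on every hypergraph N
    with nonempty edges; closed neighborhoods, and open ones when no vertex is
    isolated, form such hypergraphs.

    A move from a cover function t matters only through the function t' that it
    produces. Postponing submoves at a vertex to the last submove there keeps a
    move legal, so a move amounts to an order of the vertices together with one
    increment for each of them, and even a move with infinitely many submoves
    can be replaced by a finite one ([legal_move_rel], [move_rel_legal]). The
    relation [move_rel] between t and t' is thus a finite union of closed
    polyhedra with rational coefficients. It is also Lipschitz
    ([move_rel_lipschitz]): if t is replaced by a nearby function, then slightly
    smaller increments remain legal, and the weight lost can be spent greedily.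

    Every move but the last one has weight 1, so at most |V| + 1 moves are
    made, and at a finished position [move_rel] only allows to stay in place. So
    the values of positions come from a backward induction over |V| + 1 rounds
    ([is_value]). In each round the value is a Lipschitz function of the
    position, because the previous one and the move relation are; hence the
    optimum over the compact set of successors is attained
    ([value_exists_lipschitz]).

    The relation between a position and its value is built from [move_rel] by
    first-order quantifiers over real variables. Fourier-Motzkin elimination
    turns such a description into a finite union of polyhedra with rational
    coefficients, possibly not closed ([polyhedral_exists],
    [polyhedral_value]). The same elimination, read once over the reals and once
    over the rationals, shows that a nonempty set of this kind has a rational
    point ([polyhedral_rational_point]). Applied to the values of a rational
    position it gives their rationality, and applied to its optimal successors
    it gives an optimal rational move ([rational_optimal_move]).

    Moving to an optimal successor is a strategy that serves both players
    ([optimal_strategy_exists]); confronting it with an arbitrary strategy of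
    the opponent identifies the game value ([game_value_eq]). *)

Set Implicit Arguments.
Unset Strict Implicit.
Unset Printing Implicit Defensive.
Import Order.TTheory GRing.Theory Num.Theory.
Local Open Scope ring_scope.

(** * Fourier-Motzkin elimination with rational coefficients *)

(** Coefficients are rational whatever the field over which a form is evaluated:
    one description is read over the reals and over the rationals. *)
Definition affine (I : finType) := ({ffun I -> rat} * rat)%type.

Definition aeval (F : realFieldType) (I : finType) (a : affine I) (x : I -> F) : F :=
  \sum_i ratr (a.1 i) * x i + ratr a.2.

(** As in [lteif], the flag [true] stands for the nonstrict inequality. *)
Definition atom (I : finType) := (bool * affine I)%type.

Definition holds_atom (F : realFieldType) (I : finType) (x : I -> F) (c : atom I) : bool :=
  0 < aeval c.2 x ?<= if c.1.

Definition dnf (I : finType) := seq (seq (atom I)).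

Definition holds (F : realFieldType) (I : finType) (d : dnf I) (x : I -> F) : bool :=
  has (all (holds_atom x)) d.

Definition upd (I : eqType) (T : Type) (x : I -> T) (j : I) (y : T) : I -> T :=
  fun i => if i == j then y else x i.

Section Elimination.
Variable I : finType.
Implicit Types (a : affine I) (c : atom I) (p : seq (atom I)).

(** For l bounding the variable j from below and u bounding it from above, the
    positive combination of both in which j cancels. *)
Definition resolve (j : I) (l u : atom I) : atom I :=
  (l.1 && u.1,
   ([ffun i => l.2.1 j * u.2.1 i - u.2.1 j * l.2.1 i],
    l.2.1 j * u.2.2 - u.2.1 j * l.2.2)).

Definition eliminate_clause (j : I) p : seq (atom I) :=
  [seq c : atom I <- p | c.2.1 j == 0] ++
  [seq resolve j l u | l <- [seq c : atom I <- p | 0 < c.2.1 j],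
                       u <- [seq c : atom I <- p | c.2.1 j < 0]].

Definition eliminate (j : I) (d : dnf I) : dnf I := map (eliminate_clause j) d.

Variable F : realFieldType.
Implicit Types x z : I -> F.

Lemma aeval_upd a x j (y : F) :
  aeval a (upd x j y) = ratr (a.1 j) * y + aeval a (upd x j 0).
Proof.
rewrite /aeval (bigD1 j) //= [X in _ = _ + (X + _)](bigD1 j) //= /upd eqxx.
rewrite mulr0 add0r -addrA; congr (_ + (_ + _)).
by apply: eq_bigr => i /negbTE ->.
Qed.

Lemma aeval_resolve j (l u : atom I) x : aeval (resolve j l u).2 x =
  ratr (l.2.1 j) * aeval u.2 x - ratr (u.2.1 j) * aeval l.2 x.
Proof.
rewrite /aeval /= !mulrDr opprD addrACA rmorphB !rmorphM; congr (_ + _).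
rewrite !mulr_sumr -sumrB; apply: eq_bigr => i _.
by rewrite ffunE rmorphB !rmorphM mulrBl !mulrA.
Qed.

Lemma lteif_combine (a b p q : F) C1 C2 : 0 < a -> 0 < b ->
  0 < p ?<= if C1 -> 0 < q ?<= if C2 -> 0 < a * q + b * p ?<= if C1 && C2.
Proof. by move=> a0 b0; case: C1; case: C2 => /= ? ?; nra. Qed.

(** At equal thresholds the strict bound is the stronger one. *)
Lemma strongest_bound (s : seq (bool * F)) : s != [::] ->
  exists2 m, m \in s & forall y, m.2 < y ?<= if m.1 ->
    forall l, l \in s -> l.2 < y ?<= if l.1.
Proof.
elim: s => // b s IH _; case: (altP (s =P [::])) => [->|/IH [m ms mP]].
  by exists b; rewrite ?mem_head // => y yb l; rewrite inE => /eqP ->.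
have [lt|lt|e] := ltgtP b.2 m.2.
- exists m; first by rewrite inE ms orbT.
  move=> y my l; rewrite inE => /orP[/eqP -> | ls]; last exact: mP.
  by move: my; case: (m.1); case: (b.1) => /=; lra.
- exists b; first exact: mem_head.
  move=> y yb l; rewrite inE => /orP[/eqP -> // | ls]; apply: mP => //.
  by move: yb; case: (m.1); case: (b.1) => /=; lra.
- case: (boolP b.1) => hb.
    exists m; first by rewrite inE ms orbT.
    move=> y my l; rewrite inE => /orP[/eqP -> | ls]; last exact: mP.
    by rewrite hb e; move: my; case: (m.1) => /=; lra.
  exists b; first exact: mem_head.
  move=> y yb l; rewrite inE => /orP[/eqP -> // | ls]; apply: mP => //.
  by move: yb; rewrite e (negbTE hb); case: (m.1) => /=; lra.
Qed.

(** Only the strongest lower and the strongest upper bound count, and the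
    midpoint of their thresholds satisfies both. *)
Lemma between_bounds (ls us : seq (bool * F)) :
  (forall l u, l \in ls -> u \in us -> l.2 < u.2 ?<= if l.1 && u.1) ->
  exists y, (forall l, l \in ls -> l.2 < y ?<= if l.1) /\
            (forall u, u \in us -> y < u.2 ?<= if u.1).
Proof.
move=> H.
have uppers : us != [::] -> exists2 m, m \in us & forall y, y < m.2 ?<= if m.1 ->
    forall u, u \in us -> y < u.2 ?<= if u.1.
  move=> us0; pose neg (b : bool * F) := (b.1, - b.2).
  have negK : involutive neg by case=> ? ?; rewrite /neg /= opprK.
  have [|m mus mP] := @strongest_bound (map neg us); first by case: us us0 {H}.
  exists (neg m); first by rewrite -(mem_map (inv_inj negK)) negK.
  have negE (b : bool * F) y : (y < (neg b).2 ?<= if (neg b).1) =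
      (b.2 < - y ?<= if b.1).
    by rewrite /neg /=; case: (b.1); rewrite /= (lerNr, ltrNr).
  move=> y; rewrite negE => ym u uu.
  by rewrite -[u]negK negE mP // map_f.
have pick (y : F) : ls = [::] -> us = [::] ->
    exists y, (forall l, l \in ls -> l.2 < y ?<= if l.1) /\
              (forall u, u \in us -> y < u.2 ?<= if u.1).
  by move=> -> ->; exists y; split.
case: (altP (ls =P [::])) => [ls0|/[dup] ls0 /strongest_bound [l lls lP]];
  case: (altP (us =P [::])) => [us0|/uppers [u uus uP]].
- exact: (pick 0).
- exists (u.2 - 1); split; first by rewrite ls0.
  by apply: uP; case: (u.1) => /=; lra.
- exists (l.2 + 1); split; last by rewrite us0.
  by apply: lP; case: (l.1) => /=; lra.
- exists ((l.2 + u.2) / 2); have := H _ _ lls uus.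
  by split; [apply: lP | apply: uP]; move: H0; case: (l.1); case: (u.1) => /=; lra.
Qed.

(** One step of Fourier-Motzkin elimination: the atoms in which j occurs bound
    it from below or from above, and the resolvents say exactly that every lower
    bound is compatible with every upper bound. *)
Lemma eliminate_clauseP j p x :
  reflect (exists y, all (holds_atom (upd x j y)) p)
          (all (holds_atom x) (eliminate_clause j p)).
Proof.
have ratr0 (q : rat) : (0 < q) = (0 < ratr q :> F) by rewrite ltr0q.
have ratr0' (q : rat) : (q < 0) = (ratr q < 0 :> F) by rewrite ltrq0.
have indep a y : a.1 j = 0 -> aeval a x = aeval a (upd x j y).
  move=> a0; have {1}-> : x = upd x j (x j).
    by apply/funext => i; rewrite /upd; case: eqP => // ->.
  by rewrite aeval_upd [RHS]aeval_upd a0 rmorph0 !mul0r.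
apply: (iffP idP).
  rewrite all_cat => /andP[/allP hN /allP hR].
  pose bound (c : atom I) : bool * F :=
    (c.1, - aeval c.2 (upd x j 0) / ratr (c.2.1 j)).
  have lowE c y : 0 < c.2.1 j -> holds_atom (upd x j y) c =
      ((bound c).2 < y ?<= if (bound c).1).
    rewrite /holds_atom aeval_upd ratr0 /bound /= => c0.
    by case: (c.1);
      rewrite /= (ler_pdivrMr, ltr_pdivrMr) // -(lerBlDr, ltrBlDr) sub0r mulrC.
  have upE c y : c.2.1 j < 0 -> holds_atom (upd x j y) c =
      (y < (bound c).2 ?<= if (bound c).1).
    rewrite /holds_atom aeval_upd ratr0' /bound /= => c0.
    by case: (c.1);
      rewrite /= (ler_ndivlMr, ltr_ndivlMr) // -(lerBlDr, ltrBlDr) sub0r mulrC.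
  have [] := @between_bounds [seq bound c | c : atom I <- p & 0 < c.2.1 j]
                           [seq bound c | c : atom I <- p & c.2.1 j < 0].
    move=> _ _ /mapP[l lp ->] /mapP[u up ->].
    have := hR (resolve j l u) (allpairs_f _ lp up).
    move: lp up; rewrite !mem_filter => /andP[l0 _] /andP[u0 _].
    rewrite /holds_atom (indep _ 0); last by rewrite /= ffunE mulrC subrr.
    rewrite aeval_resolve /bound /=.
    move: l0 u0; rewrite ratr0 ratr0' => l0 u0.
    move: (ratr _) (ratr _) (aeval _ _) (aeval _ _) l0 u0 => a b p1 q1 a0 b0.
    case: (_ && _); rewrite /= (ler_pdivrMr, ltr_pdivrMr) // mulrAC
        (ler_ndivlMr, ltr_ndivlMr) // !mulNr (lerN2, ltrN2) -(subr_ge0, subr_gt0);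
      by rewrite mulrC [_ * p1]mulrC.
  move=> y [yl yu]; exists y; apply/allP => c cp.
  have [c0|c0|c0] := ltgtP (c.2.1 j) 0.
  - by rewrite upE // yu // map_f // mem_filter c0.
  - by rewrite lowE // yl // map_f // mem_filter c0.
  - by rewrite /holds_atom -indep //; apply: hN; rewrite mem_filter c0 eqxx.
move=> [y /allP hy]; rewrite all_cat; apply/andP; split; apply/allP.
  move=> c; rewrite mem_filter => /andP[/eqP c0 /hy].
  by rewrite /holds_atom -indep.
move=> _ /allpairsP[[l u] /= [+ + ->]]; rewrite !mem_filter.
move=> /andP[l0 /hy hl] /andP[u0 /hy hu].
rewrite /holds_atom (indep _ y); last by rewrite /= ffunE mulrC subrr.
rewrite aeval_resolve -mulNr; apply: lteif_combine => //.
  by rewrite -ratr0.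
by rewrite oppr_gt0 -ratr0'.
Qed.

Lemma eliminateP j (d : dnf I) x :
  holds (eliminate j d) x <-> exists y, holds d (upd x j y).
Proof.
rewrite /holds /eliminate has_map; split.
  move=> /hasP[p pd /eliminate_clauseP[y hy]].
  by exists y; apply/hasP; exists p.
move=> [y /hasP[p pd hy]]; apply/hasP; exists p => //=.
by apply/eliminate_clauseP; exists y.
Qed.

Definition eliminate_all (js : seq I) (d : dnf I) : dnf I := foldr eliminate d js.

Lemma eliminate_allP js (d : dnf I) x :
  holds (eliminate_all js d) x <->
  exists2 z, holds d z & forall i, i \notin js -> z i = x i.
Proof.
elim: js x => [|j js IH] x /=.
  split=> [|[z hz zx]]; first by exists x.
  by have <- : z = x by apply/funext => i; exact: zx.
rewrite eliminateP; split=> [[y /IH[z hz zx]]|[z hz zx]].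
  exists z => // i; rewrite inE negb_or => /andP[/negbTE ij /zx ->].
  by rewrite /upd ij.
exists (z j); apply/IH; exists z => // i ijs.
by rewrite /upd; case: eqP => [->//|/eqP ij]; apply: zx; rewrite inE negb_or ij.
Qed.

(** Together with [eliminate_allP], which holds over any field, this carries the
    solvability of a system from F down to the rationals. *)
Lemma holds_rat (d : dnf I) (q : I -> rat) :
  holds d (fun i => ratr (q i) : F) = holds d q.
Proof.
rewrite /holds; apply: eq_has => p; apply: eq_all => c; rewrite /holds_atom.
have -> : aeval c.2 (fun i => ratr (q i) : F) = ratr (aeval c.2 q).
  rewrite /aeval rmorphD rmorph_sum /= fmorph_rat; congr (_ + _).
  by apply: eq_bigr => i _; rewrite rmorphM /= fmorph_rat.
by case: (c.1); rewrite /= (ler0q, ltr0q).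
Qed.

End Elimination.

(** * Finite unions of rational polyhedra *)

Definition limit_closed (F : realFieldType) (I : finType) (S : (I -> F) -> Prop) :=
  forall x, (forall e, 0 < e -> exists2 y, S y & forall i, `|x i - y i| <= e) -> S x.

Section Polyhedral.
Variable F : realFieldType.

Definition affine_fun (I : finType) (g : (I -> F) -> F) :=
  exists a : affine I, forall x, g x = aeval a x.

(** Finite unions of rational polyhedra; with [c] the polyhedra are closed, and
    without [c] they may have open faces. Both variants are closed under union,
    intersection and affine substitution, the second one also under complement
    and projection. *)
Definition polyhedral (c : bool) (I : finType) (S : (I -> F) -> Prop) :=
  exists2 d : dnf I, c ==> all (all fst) d & forall x, S x <-> holds d x.

Lemma affine_var (I : finType) i : affine_fun (fun x : I -> F => x i).
Proof.
exists ([ffun j => (j == i)%:R], 0) => x; rewrite /aeval /= rmorph0 addr0.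
rewrite (bigD1 i) //= ffunE eqxx rmorph1 mul1r big1 ?addr0 // => j /negbTE ji.
by rewrite ffunE ji rmorph0 mul0r.
Qed.

Lemma affine_rat (I : finType) (q : rat) : affine_fun (fun=> ratr q : F) (I := I).
Proof.
exists ([ffun=> 0], q) => x; rewrite /aeval /= big1 ?add0r // => i _.
by rewrite ffunE rmorph0 mul0r.
Qed.

Lemma affine1 (I : finType) : affine_fun (fun=> 1 : F) (I := I).
Proof. by have := affine_rat I 1; rewrite rmorph1. Qed.

Lemma affine0 (I : finType) : affine_fun (fun=> 0 : F) (I := I).
Proof. by have := affine_rat I 0; rewrite rmorph0. Qed.

Lemma affine_sub (I : finType) (f g : (I -> F) -> F) :
  affine_fun f -> affine_fun g -> affine_fun (fun x => f x - g x).
Proof.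
move=> [a fa] [b gb]; exists ([ffun i => a.1 i - b.1 i], a.2 - b.2) => x.
rewrite fa gb /aeval /= rmorphB opprD addrACA; congr (_ + _).
by rewrite -sumrB; apply: eq_bigr => i _; rewrite ffunE rmorphB mulrBl.
Qed.

Lemma affine_add (I : finType) (f g : (I -> F) -> F) :
  affine_fun f -> affine_fun g -> affine_fun (fun x => f x + g x).
Proof.
move=> af ag; have := affine_sub af (affine_sub (affine0 I) ag).
by under eq_fun do rewrite sub0r opprK.
Qed.

Lemma affine_sum (I : finType) (T : Type) (r : seq T) (P : pred T)
    (f : T -> (I -> F) -> F) :
  (forall t, affine_fun (f t)) -> affine_fun (fun x => \sum_(t <- r | P t) f t x).
Proof.
move=> af; elim: r => [|t r IH].
  by under eq_fun do rewrite big_nil; exact: affine0.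
under eq_fun do rewrite big_cons.
by case: (P t) => //; exact: affine_add.
Qed.

Definition subst_affine (I J : finType) (s : I -> affine J) (a : affine I) : affine J :=
  ([ffun j => \sum_i a.1 i * (s i).1 j], \sum_i a.1 i * (s i).2 + a.2).

Lemma aeval_subst (I J : finType) (s : I -> affine J) (a : affine I) (x : J -> F) :
  aeval (subst_affine s a) x = aeval a (fun i => aeval (s i) x).
Proof.
rewrite /aeval /= rmorphD addrA rmorph_sum /=; congr (_ + _).
under [X in X + _]eq_bigr => j _ do rewrite ffunE rmorph_sum mulr_suml /=.
rewrite exchange_big -big_split /=; apply: eq_bigr => i _.
rewrite mulrDr mulr_sumr rmorphM; congr (_ + _).
by apply: eq_bigr => j _; rewrite rmorphM mulrA.
Qed.

Lemma affine_comp (I J : finType) (f : (I -> F) -> F) (h : I -> (J -> F) -> F) :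
  affine_fun f -> (forall i, affine_fun (h i)) ->
  affine_fun (fun x => f (fun i => h i x)).
Proof.
move=> [a fa] /choice[s hs]; exists (subst_affine s a) => x.
by rewrite fa aeval_subst; congr aeval; apply/funext.
Qed.

Lemma polyhedral_iff c (I : finType) (S T : (I -> F) -> Prop) :
  (forall x, S x <-> T x) -> polyhedral c S -> polyhedral c T.
Proof. by move=> ST [d dc dS]; exists d => // x; rewrite -ST. Qed.

Lemma polyhedral_weaken c (I : finType) (S : (I -> F) -> Prop) :
  polyhedral true S -> polyhedral c S.
Proof. by case=> d /= dc dS; exists d => //; rewrite dc implybT. Qed.

Lemma polyhedral_subst c (I J : finType) (S : (I -> F) -> Prop)
    (f : I -> (J -> F) -> F) : (forall i, affine_fun (f i)) -> polyhedral c S ->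
  polyhedral c (fun x => S (fun i => f i x)).
Proof.
move=> /choice[s fs] [d dc dS].
exists (map (map (fun b : atom I => (b.1, subst_affine s b.2))) d).
  case: c dc => //= dc; rewrite all_map; apply: sub_all dc => p /=.
  by rewrite all_map.
move=> x; rewrite dS /holds has_map.
have -> // : has (all (holds_atom (fun i => f i x))) d =
  has (preim (map (fun b : atom I => (b.1, subst_affine s b.2)))
    (all (holds_atom x))) d.
apply: eq_has => p /=; rewrite all_map; apply: eq_all => b /=.
rewrite /holds_atom /= aeval_subst; congr (_ < aeval _ _ ?<= if _).
by apply/funext => i; rewrite fs.
Qed.

Lemma polyhedral_le c (I : finType) (f g : (I -> F) -> F) :
  affine_fun f -> affine_fun g -> polyhedral c (fun x => f x <= g x).
Proof.
move=> af ag; have [a fga] := affine_sub ag af; apply: polyhedral_weaken.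
exists [:: [:: (true, a)]] => //= x.
by rewrite /holds /= !andbT orbF /holds_atom /= -fga subr_ge0.
Qed.

Lemma polyhedral_const c (I : finType) (P : Prop) :
  polyhedral c (fun _ : I -> F => P).
Proof.
apply: polyhedral_weaken; case: (pselect P) => hP.
  by exists [:: [::]].
by exists [::].
Qed.

Lemma polyhedral_or c (I : finType) (S T : (I -> F) -> Prop) :
  polyhedral c S -> polyhedral c T -> polyhedral c (fun x => S x \/ T x).
Proof.
move=> [d dc dS] [e ec eT]; exists (d ++ e).
  by case: c dc ec => //=; rewrite all_cat => -> ->.
move=> x; rewrite dS eT /holds has_cat; split; first by case=> ->; rewrite ?orbT.
by move=> /orP; case; [left|right].
Qed.

Lemma polyhedral_and c (I : finType) (S T : (I -> F) -> Prop) :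
  polyhedral c S -> polyhedral c T -> polyhedral c (fun x => S x /\ T x).
Proof.
move=> [d dc dS] [e ec eT]; exists [seq p ++ q | p <- d, q <- e].
  case: c dc ec => //= /allP dc /allP ec; apply/allP => _ /allpairsP[[p q] /= [pd qe ->]].
  by rewrite all_cat dc // ec.
move=> x; rewrite dS eT; split.
  move=> [/hasP[p pd hp] /hasP[q qe hq]]; apply/hasP; exists (p ++ q).
    exact: allpairs_f.
  by rewrite all_cat hp.
move=> /hasP[_ /allpairsP[[p q] /= [pd qe ->]]]; rewrite all_cat => /andP[hp hq].
by split; apply/hasP; [exists p | exists q].
Qed.

Lemma polyhedral_exists_fin c (I T : finType) (S : T -> (I -> F) -> Prop) :
  (forall t, polyhedral c (S t)) -> polyhedral c (fun x => exists t, S t x).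
Proof.
move=> sS; have : polyhedral c (fun x => exists2 t, t \in enum T & S t x).
  elim: (enum T) => [|t r IH].
    by apply: polyhedral_iff (polyhedral_const c I False) => x; split=> // -[].
  apply: polyhedral_iff (polyhedral_or (sS t) IH) => x; split.
    by case=> [?|[u ur ?]]; [exists t | exists u]; rewrite // inE ?eqxx ?ur ?orbT.
  by case=> u; rewrite inE => /orP[/eqP -> |]; [left | right; exists u].
apply: polyhedral_iff => x; split=> [[t _ ?]|[t ?]]; exists t => //.
by rewrite mem_enum.
Qed.

Lemma polyhedral_forall_fin c (I T : finType) (S : T -> (I -> F) -> Prop) :
  (forall t, polyhedral c (S t)) -> polyhedral c (fun x => forall t, S t x).
Proof.
move=> sS; have : polyhedral c (fun x => forall t, t \in enum T -> S t x).
  elim: (enum T) => [|t r IH].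
    by apply: polyhedral_iff (polyhedral_const c I True) => x; split.
  apply: polyhedral_iff (polyhedral_and (sS t) IH) => x; split.
    by case=> St Sr u; rewrite inE => /orP[/eqP ->|/Sr].
  by move=> h; split=> [|u ur]; apply: h; rewrite inE ?eqxx ?ur ?orbT.
by apply: polyhedral_iff => x; split=> h t *; apply: h; rewrite mem_enum.
Qed.

(** By the De Morgan laws it is enough to negate one atom, which exchanges
    strict and nonstrict inequalities. *)
Lemma polyhedral_not (I : finType) (S : (I -> F) -> Prop) :
  polyhedral false S -> polyhedral false (fun x => ~ S x).
Proof.
move=> [d _ dS].
have natom (b : atom I) : polyhedral false (fun x => ~~ holds_atom x b).
  exists [:: [:: (~~ b.1, ([ffun i => - b.2.1 i], - b.2.2))]] => // x.
  rewrite /holds /= andbT orbF /holds_atom /=.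
  have -> : aeval ([ffun i => - b.2.1 i], - b.2.2) x = - aeval b.2 x.
    rewrite /aeval /= rmorphN opprD -sumrN; congr (_ + _).
    by apply: eq_bigr => i _; rewrite ffunE rmorphN mulNr.
  by case: (b.1) => /=; rewrite -?leNgt -?ltNge (oppr_gt0, oppr_ge0).
apply: (@polyhedral_iff _ _ (fun x => ~~ holds d x)).
  by move=> x; split=> [/negP h /dS //|h]; apply/negP => /dS.
elim: d {dS} => [|p d IH] /=.
  by apply: polyhedral_iff (polyhedral_const _ _ True) => x; split.
suff np : polyhedral false (fun x => ~~ all (holds_atom x) p).
  apply: polyhedral_iff (polyhedral_and np IH) => x.
  by rewrite /holds /= negb_or; split=> /andP.
elim: p => [|b p IHp] /=.
  by apply: polyhedral_iff (polyhedral_const _ _ False) => x; split.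
apply: polyhedral_iff (polyhedral_or (natom b) IHp) => x.
by rewrite /= negb_and; split=> /orP.
Qed.

Definition joint (I K : finType) (x : I -> F) (z : K -> F) (i : I + K) : F :=
  match i with inl i => x i | inr k => z k end.

(** The variables in K are eliminated in place; what remains does not depend on
    their values, which are then set to 0. *)
Lemma polyhedral_exists (I K : finType) (S : (I -> F) -> (K -> F) -> Prop) :
  polyhedral false (fun x : I + K -> F => S (x \o inl) (x \o inr)) ->
  polyhedral false (fun x => exists z, S x z).
Proof.
move=> [d _ dS]; pose js : seq (I + K) := map inr (enum K).
have sE : polyhedral false (fun x : I + K -> F =>
    exists2 z, holds d z & forall i, i \notin js -> z i = x i).
  by exists (eliminate_all js d) => // x; rewrite eliminate_allP.
have aff i : affine_fun (fun x : I -> F => joint x (fun=> 0 : F) (K := K) i).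
  by case: i => i /=; [exact: affine_var | exact: affine0].
apply: polyhedral_iff (polyhedral_subst aff sE) => x; split.
  move=> [z /dS hz zx]; exists (z \o inr).
  have -> // : x = z \o inl.
  apply/funext => i; rewrite /= zx //; apply/negP.
  by move=> /mapP[].
move=> [z hz]; exists (joint x z); first exact/dS.
by case=> // k; rewrite map_f // mem_enum.
Qed.

(** Eliminating all variables leaves a condition without variables. It is true
    over F since x exists, hence true over the rationals, and read backwards
    there it yields a rational solution. *)
Lemma polyhedral_rational_point (I : finType) (S : (I -> F) -> Prop) x :
  polyhedral false S -> S x -> exists q : I -> rat, S (fun i => ratr (q i)).
Proof.
move=> [d _ dS] /dS hx.
have : holds (eliminate_all (enum I) d) (fun=> ratr 0 : F).
  by apply/eliminate_allP; exists x => // i; rewrite mem_enum.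
rewrite holds_rat => /eliminate_allP[q hq _]; exists q; apply/dS.
by rewrite holds_rat.
Qed.

(** A point outside violates, in each of the finitely many clauses, one atom by a
    positive amount, and the atoms are Lipschitz. *)
Lemma polyhedral_limit_closed (I : finType) (S : (I -> F) -> Prop) :
  polyhedral true S -> limit_closed S.
Proof.
move=> [d dc dS] x hx; apply/dS; apply/negP => /negP nd.
have away (p : seq (atom I)) : all fst p -> ~~ all (holds_atom x) p ->
    exists2 e, 0 < e & forall y, (forall i, `|x i - y i| <= e) -> ~~ all (holds_atom y) p.
  move=> /allP pc /allPn[b bp]; rewrite /holds_atom pc //= -ltNge => bx.
  pose L : F := \sum_i `|ratr (b.2.1 i)|.
  have L0 : 0 <= L by apply: sumr_ge0.
  pose e := - aeval b.2 x / (1 + L) / 2.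
  have e0 : 0 < e by rewrite /e !divr_gt0 ?oppr_gt0 //; lra.
  have bxE : aeval b.2 x = - (2 * (1 + L) * e) by rewrite /e; field; lra.
  exists e => // y xy; apply/allPn; exists b => //; rewrite pc //= -ltNge.
  have : aeval b.2 y - aeval b.2 x <= L * e.
    rewrite /aeval opprD addrACA subrr addr0 -sumrB mulr_suml; apply: ler_sum => i _.
    rewrite -mulrBr (le_trans (ler_norm _)) // normrM ler_wpM2l //.
    by rewrite distrC xy.
  by rewrite bxE; nra.
suff [e e0 he] : exists2 e, 0 < e & forall y, (forall i, `|x i - y i| <= e) -> ~~ holds d y.
  by have [y /dS Sy /he] := hx e e0; rewrite Sy.
elim: d dc nd {dS} => [|p d IH]; first by exists 1.
rewrite /holds /= negb_or => /andP[pc dc] /andP[np nd].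
have [e1 e10 h1] := away p pc np; have [e2 e20 h2] := IH dc nd.
exists (Num.min e1 e2); first by rewrite lt_min e10.
move=> y xy; rewrite negb_or h1 ?h2 // => i; have := xy i; rewrite le_min.
  by move=> /andP[].
by move=> /andP[].
Qed.

End Polyhedral.

(** * Compactness of the cube, and series of nonnegative terms *)

Module Analysis.
Import classical_sets filter topology normedtype sequences.
Import numFieldNormedType.Exports.
Local Open Scope classical_set_scope.

Section Compactness.
Variables (R : realType) (I : finType).

(** The sets of points of K whose phi-value is close to the infimum form a
    filter base; it clusters in the cube by the theorem of Tychonoff, and a
    cluster point is a minimizer as K is closed and phi continuous. Closedness
    and continuity are required only in terms of the uniform distance. *)
Lemma cube_min (K : (I -> R) -> Prop) (phi : (I -> R) -> R) (C : R) :
    (exists x, K x) -> (forall x, K x -> forall i, 0 <= x i <= 1) ->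
    limit_closed K -> 0 <= C ->
    (forall x y e, K x -> K y -> 0 <= e -> (forall i, `|x i - y i| <= e) ->
       `|phi x - phi y| <= C * e) ->
  exists2 x, K x & forall y, K y -> phi x <= phi y.
Proof.
move=> [x0 Kx0] K01 Kcl C0 phiL.
pose m := inf [set phi x | x in K].
have hinf : has_inf [set phi x | x in K].
  split; first by exists (phi x0), x0.
  exists (phi x0 - C) => _ [x Kx <-].
  have := phiL x0 x 1 Kx0 Kx ler01; rewrite mulr1 ler_norml => h.
  suff /h /andP[_] : forall i, `|x0 i - x i| <= 1 by lra.
  by move=> i; rewrite ler_norml; have := K01 _ Kx i; have := K01 _ Kx0 i; lra.
have mle y : K y -> m <= phi y by move=> Ky; apply: ge_inf; [case: hinf | exists y].
pose B e : set (prod_topology (fun _ : I => R)) := [set x | K x /\ phi x < m + e].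
pose F := filter_from [set e : R | 0 < e] B.
have FF : ProperFilter F.
  apply: filter_from_proper; last first.
    move=> e /= e0; have [|_ [x Kx <-] hx] := @inf_adherent _ [set phi x | x in K] e e0 => //.
    by exists x.
  apply: filter_from_filter; first by exists 1 => /=.
  move=> e1 e2 /= e10 e20; exists (Num.min e1 e2) => /=; first by rewrite lt_min e10.
  move=> x [Kx hx]; have := ge_min e1 e1 e2; have := ge_min e2 e1 e2.
  by rewrite !lexx orbT /= => h1 h2; split; split=> //; lra.
pose box : set (prod_topology (fun _ : I => R)) := [set x | forall i, `[0, 1]%classic (x i)].
have Fbox : F box.
  by exists 1 => //= x [Kx _] i; rewrite /= in_itv /= K01.
have [p [_ clp]] := @tychonoff I (fun=> R) (fun=> `[0, 1]%classic)
  (fun=> @segment_compact R 0 1) F FF Fbox.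
have near_p e d : 0 < e -> 0 < d ->
    exists x, [/\ K x, phi x < m + d & forall i, `|p i - x i| <= e].
  move=> e0 d0.
  have : nbhs p (fun x : prod_topology (fun _ : I => R) => forall i, `|p i - x i| <= e).
    apply: (@filter_forall _ I
      (fun i (x : prod_topology (fun _ : I => R)) => `|p i - x i| <= e) (nbhs p)) => i.
    apply: (@proj_continuous I (fun=> R) i p [set y | `|p i - y| <= e]).
    by apply/nbhs_ballP; exists e => //= y; rewrite /ball /= => /ltW.
  move=> /(clp _ _ (_ : F (B d))) [|x [[Kx hx] px]]; first by exists d.
  by exists x; split.
have Kp : K p by apply: Kcl => e e0; have [x [Kx _ px]] := near_p e 1 e0 ltr01; exists x.
exists p => // y /mle; apply: le_trans; apply/ler_addgt0Pr => e e0.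
have [||x [Kx hx px]] := near_p (e / 2 / (1 + C)) (e / 2); [by rewrite !divr_gt0 //; lra | by lra |].
have := phiL p x _ Kp Kx _ px; rewrite ler_norml => /(_ _)/andP[|_].
  by rewrite !divr_ge0 //; lra.
have : C * (e / 2 / (1 + C)) <= e / 2.
  rewrite mulrA ler_pdivrMr; last by lra.
  nra.
lra.
Qed.
End Compactness.

Section Series.
Variables (R : realType) (u : nat -> R).
Hypothesis u0 : forall k, 0 <= u k.

Lemma partial_sum_le_series n :
  ((\sum_(k < n) u k)%:E <= \sum_(0 <= k <oo) (u k)%:E)%E.
Proof.
have := @nneseries_lim_ge R (fun k => (u k)%:E) xpredT 0 n.
by rewrite sumEFin big_mkord; apply => k _ _; rewrite lee_fin.
Qed.

Lemma lt_series_partial_sum (x : R) :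
  (x%:E < \sum_(0 <= k <oo) (u k)%:E)%E -> exists n, x < \sum_(k < n) u k.
Proof.
move=> xu; apply: contrapT => h; move: xu; apply/negP; rewrite -leNgt.
apply: lime_le; first by apply: is_cvg_nneseries => k _ _; rewrite lee_fin.
apply: nearW => n; rewrite sumEFin big_mkord lee_fin leNgt; apply/negP => hn.
by apply: h; exists n.
Qed.

End Series.

Lemma series_finite_support (R : realType) (u : nat -> R) n :
  (forall k, (n <= k)%N -> u k = 0) ->
  (\sum_(0 <= k <oo) (u k)%:E = (\sum_(k < n) u k)%:E)%E.
Proof.
move=> un; apply: lim_near_cst; first exact: ereal_hausdorff.
exists n => // k /= nk; rewrite sumEFin (big_cat_nat _ nk) //=.
rewrite [X in _ + X]big_nat_cond [X in _ + X]big1 ?addr0 ?big_mkord // => i.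
by rewrite andbT => /andP[/un].
Qed.

End Analysis.
Import Analysis.

(** * Legal moves and the covers that they produce *)

Section Moves.
Variables (R : realType) (V : finType) (N : {set {set V}}).
Implicit Types (t d : V -> R) (m : game_move R V) (A B F : {set V}).

Definition covered t := forall F, F \in N -> 1 <= \sum_(v in F) t v.

(** The increments [d] can be made from [t], each vertex being incremented at
    once, in some order of the vertices. The order is hidden in the
    quantification over A: the last vertex of A to be incremented fits into some
    edge F, which by then has received all increments at F :&: A. Conversely
    such an order is found by removing last vertices one at a time
    ([playable_order]). This form makes the condition visibly a positive
    combination of nonstrict linear inequalities. *)
Definition playable t d := forall A u0, u0 \in A ->
  exists u, u \in A /\ (d u <= 0 \/
    exists F, [/\ F \in N, u \in F &
                  \sum_(v in F) t v + \sum_(v in F :&: A) d v <= 1]).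

(** The last conjunct expresses the rule on the total weight: 1, or less in the
    last move of the game. *)
Definition move_rel t t' :=
  [/\ forall v, t v <= t' v,
      playable t (fun v => t' v - t v),
      \sum_v (t' v - t v) <= 1
    & 1 <= \sum_v (t' v - t v) \/ covered t'].

Lemma loadE t F : (load t F = 1) <-> (1 <= \sum_(v in F) t v).
Proof. by rewrite /load; split=> /min_idPl. Qed.

Lemma finishedE t : finished N t <-> covered t.
Proof. by split=> h F /h /loadE. Qed.

Lemma load_lt1 t F : load t F < 1 -> load t F = \sum_(v in F) t v.
Proof. by rewrite /load minElt; case: ifP => //; rewrite ltxx. Qed.

Section LegalMoves.
Variables (t : V -> R) (m : game_move R V).
Hypothesis legal : legal_move N t m.

Let total_le1 : (move_weight m [set: V]%SET <= 1)%E.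
Proof. by case: legal => _ [->|[]]. Qed.

Let weight0 B k : 0 <= submove_weight m B k.
Proof.
rewrite /submove_weight; case e : (submove m k) => [[u w]|//].
by case: ifP => // _; have [/andP[]] := legal.1 _ _ _ e.
Qed.

Let partial B k : R := \sum_(i < k) submove_weight m B i.
Let d v : R := fine (move_weight m [set v]%SET).

Let move_weightE B : move_weight m B = (\sum_(v in B) d v)%:E.
Proof.
have sumE A : move_weight m A = (\sum_(v in A) move_weight m [set v]%SET)%E.
  rewrite -sequences.nneseries_sum; last by move=> v k _; rewrite lee_fin.
  apply: sequences.eq_eseriesr => k _; rewrite sumEFin; congr _%:E.
  rewrite /submove_weight; case: (submove m k) => [[u w]|]; last by rewrite big1.
  rewrite -big_mkcondr /=; case: (boolP (u \in A)) => uA.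
    rewrite (big_pred1 u) // => v /=; rewrite in_set1 [v == u]eq_sym.
    by case: eqP => [<-|]; rewrite ?uA ?andbF.
  by rewrite big1 // => v /andP[vA]; rewrite in_set1 => /eqP uv; rewrite uv vA in uA.
have fin v : move_weight m [set v]%SET = (d v)%:E.
  rewrite /d fineK //; apply/fin_real/andP; split.
    apply: lt_le_trans (_ : (0%:E <= _)%E); first exact: ltNyr.
    by apply: sequences.nneseries_ge0 => k _ _; rewrite lee_fin.
  apply: le_lt_trans (ltry 1); apply: le_trans total_le1.
  apply: sequences.lee_nneseries => k _; first by rewrite lee_fin.
  move: (weight0 [set: V]%SET k); rewrite lee_fin /submove_weight.
  by case: (submove m k) => // -[u w]; rewrite in_setT; case: ifP.
by rewrite sumE -sumEFin; apply: eq_bigr => v _.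
Qed.


Let partial_le B k : partial B k <= \sum_(v in B) d v.
Proof. by rewrite -lee_fin -move_weightE; exact: partial_sum_le_series. Qed.

Let lt_partial B x : x < \sum_(v in B) d v -> exists k, x < partial B k.
Proof. by rewrite -lte_fin -move_weightE; exact: lt_series_partial_sum. Qed.

Let partialS B k : partial B k.+1 = partial B k + submove_weight m B k.
Proof. by rewrite /partial big_ord_recr. Qed.

Let partial_mono B : {homo partial B : k l / (k <= l)%N >-> k <= l}.
Proof.
apply: homo_leq => [x|y x z|k]; [exact: lexx | exact: le_trans |].
by rewrite partialS lerDl.
Qed.

Let partial_sub A B k : A \subset B -> partial A k <= partial B k.
Proof.
move=> AB; apply: ler_sum => i _; move: (weight0 B i); rewrite /submove_weight.
case: (submove m i) => // -[u w].
by case: (boolP (u \in A)) => [/(subsetP AB) ->|].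
Qed.

Let positive_submove B k : 0 < submove_weight m B k ->
  exists u F, [/\ u \in B, F \in N, u \in F &
    \sum_(v in F) t v + partial F k.+1 <= 1].
Proof.
rewrite {1}/submove_weight; case e : (submove m k) => [[u w]|]; last by rewrite ltxx.
case: ifP => [uB w0|]; last by rewrite ltxx.
have [_ [F [FN uF hF]]] := legal.1 _ _ _ e; exists u, F; split=> //.
rewrite -load_lt1.
  by rewrite partialS addrA /submove_weight e uF.
apply: lt_le_trans hF; rewrite -addrA ltrDl ltr_wpDl //.
by apply: sumr_ge0 => i _.
Qed.

(** Suppose that A is a counterexample. Every edge F that meets A must then
    exceed load 1 at some finite time, counting only its initial load and the
    increments at F :&: A. When the last of these edges exceeds 1, a positive
    submove is made at a vertex of A; this submove is legal for some edge, which
    is still at most 1 afterwards. If all edges exceed 1 from the outset, the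
    same contradiction comes from any positive submove in A. *)
Let legal_playable : playable t d.
Proof.
move=> A u0 u0A; apply: contrapT => stuck.
have {}stuck u : u \in A -> 0 < d u /\
    forall F, F \in N -> u \in F -> 1 < \sum_(v in F) t v + \sum_(v in F :&: A) d v.
  move=> uA; split.
    by rewrite ltNge; apply/negP => ?; apply: stuck; exists u; split; [|left].
  move=> F FN uF; rewrite ltNge; apply/negP => ?.
  by apply: stuck; exists u; split; [|right; exists F].
have [k0 hk0] : exists k, 0 < partial [set u0]%SET k.
  by apply: lt_partial; rewrite big_set1; case: (stuck _ u0A).
have ex_time F : exists k, F \in N -> F :&: A != set0 ->
    1 < \sum_(v in F) t v + partial (F :&: A) k.
  case: (boolP ((F \in N) && (F :&: A != set0))) => [/andP[FN /set0Pn[u]]|nF].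
    rewrite inE => /andP[uF uA].
    have := (stuck _ uA).2 _ FN uF; rewrite -ltrBlDl => /lt_partial[k hk].
    by exists k; rewrite -ltrBlDl.
  by exists 0%N => FN F0; rewrite FN F0 in nF.
have [time timeP] := choice ex_time.
(* the times at which all edges that meet A exceed 1 *)
pose late k := [forall F, (F \in N) && (F :&: A != set0) ==>
  (1 < \sum_(v in F) t v + partial (F :&: A) k)].
have : exists k, late k.
  exists (\max_F time F); apply/forallP => F; apply/implyP => /andP[FN F0].
  apply: lt_le_trans (timeP F FN F0) _; rewrite lerD2l.
  by apply: partial_mono; exact: leq_bigmax.
move=> /ex_minnP[[|k] /forallP lateP minP].
  have [k hk] : exists k, 0 < submove_weight m [set u0]%SET k.
    apply: contrapT => h; move: hk0; rewrite /partial big1 ?ltxx // => i _.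
    apply/eqP; rewrite eq_le weight0 andbT leNgt; apply/negP => hi.
    by apply: h; exists i.
  have [u [F [+ FN uF]]] := positive_submove hk; rewrite in_set1 => /eqP uu0.
  have := lateP F; rewrite FN /=; have -> /= : F :&: A != set0.
    by apply/set0Pn; exists u; rewrite inE uF uu0.
  rewrite /partial big_ord0 addr0 => h1 h2.
  have : 0 <= partial F k.+1 by apply: sumr_ge0.
  by rewrite /partial in h2 *; lra.
have : ~~ late k by apply/negP => /minP; rewrite ltnn.
rewrite negb_forall => /existsP[F]; rewrite negb_imply -leNgt => /andP[/andP[FN F0] hF].
have := lateP F; rewrite FN F0 partialS /= => hF'.
have /positive_submove[u [G [+ GN uG hG]]] : 0 < submove_weight m (F :&: A) k.
  by move: hF hF'; lra.
rewrite inE => /andP[_ uA]; have := lateP G; rewrite GN /=.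
have -> /= : G :&: A != set0 by apply/set0Pn; exists u; rewrite inE uG.
have := @partial_sub (G :&: A) G k.+1 (subsetIl _ _).
by move: hG; lra.
Qed.

Lemma legal_move_rel : move_rel t (apply_move t m).
Proof.
have dE : (fun v => apply_move t m v - t v) = d.
  by apply/funext => v; rewrite /apply_move addrC addKr.
have sumE : \sum_v (apply_move t m v - t v) = \sum_(v in [set: V]) d v.
  by apply: eq_big => v; [rewrite inE | rewrite -dE].
split.
- move=> v; rewrite -subr_ge0; have -> : apply_move t m v - t v = d v by rewrite -dE.
  by have := @partial_le [set v]%SET 0; rewrite /partial big_ord0 big_set1.
- by rewrite dE; exact: legal_playable.
- by rewrite sumE -lee_fin -move_weightE.
- case: legal => _ [e|[_ /finishedE]]; last by right.
  by left; rewrite sumE -lee_fin -move_weightE e.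
Qed.

End LegalMoves.

(** The vertex that [playable] provides for A is put last, and induction orders
    the others. *)
Lemma playable_order t d A : playable t d -> (forall v, v \in A -> 0 < d v) ->
  exists s, [/\ uniq s, s =i A & forall s1 u s2, s = rcons s1 u ++ s2 ->
    exists F, [/\ F \in N, u \in F &
      \sum_(v in F) t v + \sum_(v <- rcons s1 u | v \in F) d v <= 1]].
Proof.
move=> pl; have [n] := ubnP #|A|; elim: n A => // n IH A An dA.
have [->|[u0 u0A]] := set_0Vmem A.
  by exists [::]; split=> // [v|[|x s1] u s2]; rewrite ?inE.
have [u [uA [|[F [FN uF hF]]]]] := pl A u0 u0A; first by rewrite leNgt dA.
have [||s [us sA sP]] := IH (A :\ u).
- by rewrite (cardsD1 u) uA in An.
- by move=> v; rewrite inE => /andP[_ /dA].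
have uns : u \notin s by rewrite sA !inE eqxx.
have ss : rcons s u =i A.
  by move=> v; rewrite mem_rcons inE sA !inE; case: eqP => // ->.
have urs : uniq (rcons s u) by rewrite rcons_uniq uns.
exists (rcons s u); split=> // s1 w s2; case/lastP: s2 => [|s2 x].
  rewrite cats0 => e; exists F; rewrite -e.
  have [_ <-] := rcons_inj e; split=> //.
  suff -> : \sum_(v <- rcons s u | v \in F) d v = \sum_(v in F :&: A) d v by [].
  rewrite -big_filter -[RHS]big_enum; apply/perm_big/uniq_perm.
  - by rewrite filter_uniq.
  - exact: enum_uniq.
  - by move=> v; rewrite mem_filter mem_enum inE ss.
by rewrite -rcons_cat => /rcons_inj[/sP].
Qed.

Definition move_of d (s : seq V) : game_move R V := FiniteMove [seq (v, d v) | v <- s].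

Lemma sum_submove_weight d s B k :
  \sum_(i < k) submove_weight (move_of d s) B i = \sum_(v <- take k s | v \in B) d v.
Proof.
elim: s k => [|x s IH] k.
  by rewrite big_nil big1 // => i _; rewrite /submove_weight /= ?nth_nil; case: i => -[].
case: k => [|k]; first by rewrite big_ord0 big_nil.
rewrite big_ord_recl /= big_cons /= -IH /submove_weight /=.
by case: ifP => _ //; rewrite add0r.
Qed.

Lemma move_weight_finite d s B :
  move_weight (move_of d s) B = (\sum_(v <- s | v \in B) d v)%:E.
Proof.
rewrite -{2}[s]take_size -sum_submove_weight /move_weight.
apply: series_finite_support => k sk; rewrite /submove_weight /= onth_map.
by rewrite (_ : onth s k = None) // onthE nth_default ?size_map.
Qed.

Definition rational_valued t := forall v, exists q : rat, t v = ratr q.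

(** Converse of [legal_move_rel]: whatever a legal move achieves is achieved by a
    finite one, with one submove for each vertex that is incremented. The weights
    are differences of cover values, hence rational between rational covers. *)
Lemma move_rel_legal t t' : move_rel t t' ->
  exists m, [/\ legal_move N t m, finitely_many_submoves m, apply_move t m = t' &
    rational_valued t -> rational_valued t' -> rational_weights m].
Proof.
move=> [tt' pl le1 done]; set d := (fun v => t' v - t v) in pl.
have d0 v : 0 <= d v by rewrite subr_ge0.
have [|s [us sA sP]] := @playable_order t d [set v | 0 < d v] pl.
  by move=> v; rewrite inE.
have sumE B : \sum_(v <- s | v \in B) d v = \sum_(v in B) d v.
  rewrite big_mkcond big_uniq //= [RHS]big_mkcond [RHS](bigID [in s]) /=.
  rewrite [X in _ = _ + X]big1 ?addr0 // => v.
  rewrite sA inE -leNgt => dv; case: ifP => // _.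
  by apply/eqP; rewrite eq_le dv d0.
have applyE : apply_move t (move_of d s) = t'.
  apply/funext => v; rewrite /apply_move move_weight_finite sumE /= big_set1.
  by rewrite /d addrC subrK.
have submoveE k u w : submove (move_of d s) k = Some (u, w) ->
    w = d u /\ s = rcons (take k s) u ++ drop k.+1 s.
  rewrite /= onth_map; case e : (onth s k) => [x|] //= [<- <-]; split=> //.
  have ks : (k < size s)%N.
    by rewrite ltnNge; apply/negP => ?; move: e; rewrite onthE nth_default ?size_map.
  by rewrite -(onth_nth x _ _ _ e) -take_nth // cat_take_drop.
exists (move_of d s); split=> //; last 2 first.
- by exists [seq (v, d v) | v <- s].
- move=> tq tq' k u w /submoveE[-> _]; have [q tuq] := tq u; have [q' tuq'] := tq' u.
  by exists (q' - q); rewrite /d tuq tuq' rmorphB.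
have totalE : move_weight (move_of d s) (setTfor V) = (\sum_v d v)%:E.
  by rewrite move_weight_finite sumE; congr _%:E; apply: eq_bigl => v; rewrite inE.
split.
  move=> k u w /submoveE[-> sE]; split.
    rewrite d0 (le_trans _ le1) // (bigD1 u) //= lerDl.
    by apply: sumr_ge0 => v _; exact: d0.
  have [F [FN uF hF]] := sP _ _ _ sE; exists F; split=> //.
  rewrite sum_submove_weight -addrA (le_trans _ hF) // lerD ?ge_min ?lexx ?orbT //.
  by rewrite -cats1 big_cat big_cons big_nil uF /= addr0.
rewrite totalE applyE finishedE lee_fin.
by case: done => h; [left; congr _%:E; apply/eqP; rewrite eq_le le1 | right].
Qed.

End Moves.

(** * Continuity of the move relation *)

Section MoveRelation.
Variables (R : realType) (V : finType) (N : {set {set V}}).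
Hypothesis N0 : set0 \notin N.
Implicit Types (t d : V -> R) (A B F : {set V}).

Definition in_cube t := forall v, 0 <= t v <= 1.

(** The case of a singleton in [playable]. *)
Lemma playable_edge t d v : playable N t d -> 0 < d v ->
  exists F, [/\ F \in N, v \in F & \sum_(u in F) t u + d v <= 1].
Proof.
move=> pl dv; have [_ [/set1P -> [|[F [FN vF hF]]]]] := pl [set v] v (set11 v).
  by rewrite leNgt dv.
exists F; split=> //; move: hF; rewrite (_ : F :&: [set v] = [set v]) ?big_set1 //.
by apply/setIidPr; rewrite sub1set.
Qed.

Lemma move_rel_in_cube t t' : move_rel N t t' -> in_cube t -> in_cube t'.
Proof.
move=> [tt' pl _ _] t01 v; have /andP[tv0 tv1] := t01 v.
apply/andP; split; first exact: le_trans (tt' v).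
have [e|lt|e] := ltgtP (t v) (t' v); last by rewrite -e.
  have [|F [FN vF]] := playable_edge pl (v := v); first by rewrite subr_gt0.
  rewrite (bigD1 v) //= => hF.
  have : 0 <= \sum_(u in F | u != v) t u.
    by apply: sumr_ge0 => u _; case/andP: (t01 u).
  by lra.
by have := tt' v; rewrite leNgt lt.
Qed.

(** Finished positions are fixed, so a game may be continued idly to any given
    number of rounds. *)
Lemma move_rel_covered t t' : covered N t -> move_rel N t t' -> t' = t.
Proof.
move=> ct [tt' pl _ _]; apply/funext => v; apply/eqP; rewrite eq_le tt' andbT.
rewrite leNgt; apply/negP => lt.
have [|F [FN vF]] := playable_edge pl (v := v); first by rewrite subr_gt0.
by have := ct F FN; lra.
Qed.

(** Total lack of load; it bounds the weight that can still be spent. *)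
Definition gap t : R := \sum_(F in N) Num.max 0 (1 - \sum_(v in F) t v).

Lemma gap_ge0 t : 0 <= gap t.
Proof. by apply: sumr_ge0 => F _; rewrite le_max lexx. Qed.

(** Greedy continuation: as long as some edge F is not full, a vertex of F is
    incremented until F is full or the weight 1 is used up. Each step lowers
    [gap] by at least the weight that it spends. *)
Lemma playable_extend t d : (forall v, 0 <= d v) -> playable N t d ->
    \sum_v d v <= 1 ->
  exists d', [/\ forall v, d v <= d' v, playable N t d', \sum_v d' v <= 1,
    1 <= \sum_v d' v \/ covered N (fun v => t v + d' v)
    & \sum_v d' v - \sum_v d v <= gap (fun v => t v + d v)].
Proof.
pose open d F := (F \in N) && (\sum_(v in F) (t v + d v) < 1).
have [n] := ubnP #|[set F | open d F]|; elim: n d => // n IH d dn d0 pl d1.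
case: (pickP (open d)) => [F /andP[FN ltF]|none]; last first.
  exists d; split=> //; last by rewrite subrr gap_ge0.
  right=> F FN; rewrite leNgt; apply/negP => h.
  by have := none F; rewrite /open FN h.
have [u uF] : exists u, u \in F by apply/set0Pn; apply: contraNneq N0 => <-.
set a := 1 - \sum_(v in F) (t v + d v); pose w := Num.min a (1 - \sum_v d v).
have a0 : 0 < a by rewrite subr_gt0.
have w0 : 0 <= w by rewrite le_min ltW // subr_ge0.
have wa : w <= a by rewrite ge_min lexx.
pose e v : R := if v == u then w else 0.
have sum_e B : \sum_(v in B) e v = if u \in B then w else 0.
  rewrite /e -big_mkcondr /=; case: (boolP (u \in B)) => uB.
    by rewrite (big_pred1 u) // => v /=; case: eqP => [->|]; rewrite ?uB ?andbF.
  by rewrite big1 // => v /andP[vB /eqP vu]; rewrite -vu vB in uB.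
have e0 v : 0 <= e v by rewrite /e; case: ifP.
pose d2 v := d v + e v.
have sum_d2 B : \sum_(v in B) d2 v = \sum_(v in B) d v + if u \in B then w else 0.
  by rewrite big_split /= sum_e.
have sumT f : \sum_(v in [set: V]) f v = \sum_v f v :> R.
  by apply: eq_bigl => v; rewrite inE.
have total2 : \sum_v d2 v = \sum_v d v + w by rewrite -sumT sum_d2 inE sumT.
have dd2 v : d v <= d2 v by rewrite lerDl.
have pl2 : playable N t d2.
  move=> A u0 u0A; case: (boolP (u \in A)) => uA.
    exists u; split=> //; right; exists F; split=> //.
    rewrite sum_d2 inE uF uA.
    have : \sum_(v in F :&: A) d v <= \sum_(v in F) d v.
      rewrite [leRHS](big_setID A) /= lerDl.
      by apply: sumr_ge0.
    by move: wa; rewrite /a big_split /=; lra.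
  have [u1 [u1A h]] := pl A u0 u0A; exists u1; split=> //.
  have -> : d2 u1 = d u1.
    by rewrite /d2 /e; case: eqP u1A => [->|]; rewrite ?(negbTE uA) ?addr0.
  case: h => [?|[G [GN uG hG]]]; [by left | right; exists G].
  by rewrite sum_d2 inE (negbTE uA) andbF addr0.
have gap2 : gap (fun v => t v + d2 v) + w <= gap (fun v => t v + d v).
  rewrite /gap (bigD1 F) //= [leRHS](bigD1 F) //= addrAC lerD //.
    have -> : \sum_(v in F) (t v + d2 v) = \sum_(v in F) (t v + d v) + w.
      by rewrite !big_split /= sum_e uF addrA.
    rewrite [leRHS]max_r; last by rewrite subr_ge0 ltW.
    by rewrite max_r; move: wa; rewrite /a; lra.
  apply: ler_sum => G _; rewrite ge_max le_max lexx /= le_max lerD2l lerN2.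
  by apply/orP; right; apply: ler_sum => v _; rewrite lerD2l.
have d21 : \sum_v d2 v <= 1.
  by rewrite total2 -lerBrDl /w ge_min lexx orbT.
have [le|lt] := leP (1 - \sum_v d v) a.
  have we : w = 1 - \sum_v d v by rewrite /w min_r.
  exists d2; split=> //; first by left; rewrite total2 we; lra.
  by rewrite total2; have := gap_ge0 (fun v => t v + d2 v); lra.
have we : w = a by rewrite /w min_l // ltW.
have [||||d' [dd' pl' d'1 fin gap']] := IH d2 => //.
- rewrite -ltnS (leq_trans _ dn) // ltnS; apply: proper_card.
  rewrite properE; apply/andP; split.
    apply/subsetP => G; rewrite !inE /open => /andP[-> /=].
    by apply: le_lt_trans; apply: ler_sum => v _; rewrite lerD2l.
  apply/subsetPn; exists F; rewrite !inE /open FN //= -leNgt.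
  rewrite (_ : \sum_(v in F) (t v + d2 v) = \sum_(v in F) (t v + d v) + w); last first.
    by rewrite !big_split /= sum_e uF addrA.
  by rewrite we /a addrC subrK.
- by move=> v; rewrite addr_ge0.
exists d'; split=> //; first by move=> v; apply: le_trans (dd' v).
by rewrite total2 in gap'; lra.
Qed.

Lemma move_rel_exists t : exists t', move_rel N t t'.
Proof.
have [||d [d0 pl d1 fin _]] := @playable_extend t (fun=> 0) (fun=> lexx 0).
- by move=> A u uA; exists u; split; [|left].
- by rewrite big1.
exists (fun v => t v + d v); split=> //.
- by move=> v; rewrite lerDl d0.
- by under eq_fun do rewrite addrC addKr.
- by under eq_bigr do rewrite addrC addKr.
- by under eq_bigr do rewrite addrC addKr.
Qed.

(** Let n = |V|. Moving from s to t raises the load of an edge by at most n * e,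
    so lowering each increment by n * e, or to 0, keeps the move playable. It
    loses at most n * n * e of the weight; [playable_extend] makes up for this,
    and needs little weight for it: if the original move had weight 1, at most
    what was lost, and if it ended the game, at most the gap left, which is of
    order e. *)
Lemma move_rel_lipschitz : exists2 C : R, 0 <= C & forall s t s' e,
  0 <= e -> (forall v, `|s v - t v| <= e) -> move_rel N s s' ->
  exists2 t', move_rel N t t' & forall v, `|s' v - t' v| <= C * e.
Proof.
pose n : R := #|V|%:R; pose k : R := #|N|%:R.
have n0 : 0 <= n by rewrite ler0n.
have k0 : 0 <= k by rewrite ler0n.
exists (1 + n + n * n + k * (n * (1 + n))); first by rewrite !addr_ge0 ?mulr_ge0 ?addr_ge0.
move=> s t s' e e0 st [ss' pl s1 fin].
have card_le B : #|B|%:R <= n :> R by rewrite ler_nat max_card.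
have sum_cst B (c : R) : 0 <= c -> \sum_(v in B) c <= n * c.
  by move=> c0; rewrite sumr_const -mulr_natl ler_wpM2r.
pose d v := s' v - s v; pose d2 v := Num.max 0 (d v - n * e).
have d0 v : 0 <= d v by rewrite subr_ge0.
have ne0 : 0 <= n * e by rewrite mulr_ge0.
have d20 v : 0 <= d2 v by rewrite le_max lexx.
have d2d v : d2 v <= d v by rewrite ge_max d0 gerBl.
have dd2 v : d v - n * e <= d2 v by rewrite le_max lexx orbT.
have st1 v : t v <= s v + e by have := st v; rewrite ler_norml; lra.
have st2 v : s v - e <= t v by have := st v; rewrite ler_norml; lra.
have pl2 : playable N t d2.
  move=> A u0 u0A; have [u [uA h]] := pl A u0 u0A; exists u; split=> //.
  have [d2u|d2u] := leP (d2 u) 0; [by left | right].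
  case: h => [du|[F [FN uF hF]]]; first by have := d2d u; rewrite /d; lra.
  exists F; split=> //; apply: le_trans hF.
  have tF : \sum_(v in F) t v <= \sum_(v in F) s v + n * e.
    apply: le_trans (_ : \sum_(v in F) (s v + e) <= _); first exact: ler_sum.
    by rewrite big_split /= lerD2l sum_cst.
  have d2u' : d2 u = d u - n * e.
    by move: d2u; rewrite /d2 lt_max ltxx /= => /ltW/max_r.
  have dF : \sum_(v in F :&: A) d2 v + n * e <= \sum_(v in F :&: A) d v.
    rewrite (bigD1 u) ?inE ?uF //= [leRHS](bigD1 u) ?inE ?uF //= d2u' addrAC subrK.
    by rewrite lerD2l; apply: ler_sum.
  by rewrite /d in dF; lra.
have total2 : \sum_v d2 v <= 1 by apply: le_trans s1; apply: ler_sum.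
have [d3 [d23 pl3 d31 fin3 gap3]] := playable_extend d20 pl2 total2.
pose t' v := t v + d3 v.
have t'E : (fun v => t' v - t v) = d3 by apply/funext => v; rewrite /t' addrC addKr.
have sumE : \sum_v (t' v - t v) = \sum_v d3 v by rewrite -t'E.
have extra : \sum_v d3 v - \sum_v d2 v <= (n * n + k * (n * (1 + n))) * e.
  have kn0 : 0 <= k * (n * (1 + n)) * e by rewrite !mulr_ge0 // addr_ge0.
  case: fin => [s1'|cs'].
    have : \sum_v (d v - n * e) <= \sum_v d2 v by exact: ler_sum.
    rewrite sumrB; have := sum_cst [set: V]%SET (n * e) ne0.
    under eq_bigl do rewrite inE.
    by rewrite -/(\sum_v d v) in s1'; lra.
  apply: le_trans gap3 _; apply: le_trans (_ : k * (n * ((1 + n) * e)) <= _); last first.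
    have : 0 <= n * n * e by rewrite !mulr_ge0.
    by lra.
  rewrite /gap /k -sum1_card natr_sum mulr_suml; apply: ler_sum => F FN.
  rewrite mul1r ge_max !mulr_ge0 ?addr_ge0 //=.
  have := cs' F FN.
  have : \sum_(v in F) s' v <= \sum_(v in F) (t v + d2 v) + n * ((1 + n) * e).
    apply: le_trans (_ : \sum_(v in F) ((t v + d2 v) + (1 + n) * e) <= _).
      apply: ler_sum => v _; have := st2 v; have := dd2 v; rewrite /d; lra.
    by rewrite big_split /= lerD2l sum_cst // mulr_ge0 // addr_ge0.
  by lra.
have d3v v : d3 v - d2 v <= (n * n + k * (n * (1 + n))) * e.
  apply: le_trans extra; rewrite -sumrB (bigD1 v) //= lerDl.
  by apply: sumr_ge0 => u _; rewrite subr_ge0.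
exists t'; last first.
  move=> v; have -> : s' v - t' v = (s v - t v) + (d v - d2 v) + (d2 v - d3 v).
    by rewrite /d /t'; ring.
  apply: le_trans (ler_normD _ _) _; apply: le_trans (lerD (ler_normD _ _) (lexx _)) _.
  rewrite [`|d v - _|]ger0_norm ?subr_ge0 //.
  rewrite [`|d2 v - _|]distrC [`|d3 v - _|]ger0_norm ?subr_ge0 //.
  by have := d3v v; have := dd2 v; have := st v; lra.
split.
- by move=> v; rewrite lerDl (le_trans (d20 v)).
- by rewrite t'E.
- by rewrite sumE.
- by rewrite sumE.
Qed.

(** Stated for covers that depend affinely on parameters x, to allow for
    constants and for any naming of the variables. *)
Lemma polyhedral_move_rel c (I : finType) (f g : V -> (I -> R) -> R) :
  (forall v, affine_fun (f v)) -> (forall v, affine_fun (g v)) ->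
  polyhedral c (fun x => move_rel N (f^~ x) (g^~ x)).
Proof.
move=> af ag; have adiff v : affine_fun (fun x => g v x - f v x) by exact: affine_sub.
have inc : polyhedral c (fun x => forall v, f v x <= g v x).
  by apply: polyhedral_forall_fin => v; apply: polyhedral_le.
have play : polyhedral c (fun x => playable N (f^~ x) (fun v => g v x - f v x)).
  apply: (@polyhedral_forall_fin _ c I {set V}) => A.
  apply: (@polyhedral_forall_fin _ c I V) => u0.
  case: (boolP (u0 \in A)) => u0A; last first.
    by apply: polyhedral_iff (@polyhedral_const R c I True) => x; split.
  suff : polyhedral c (fun x => exists u, u \in A /\ (g u x - f u x <= 0 \/
    exists F, F \in N /\ (u \in F /\
       \sum_(v in F) f v x + \sum_(v in F :&: A) (g v x - f v x) <= 1))).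
    apply: polyhedral_iff => x; split.
      move=> [u [uA h]] _; exists u; split=> //.
      by case: h => [|[F [? []]]]; [left | right; exists F].
    move=> /(_ isT)[u [uA h]]; exists u; split=> //.
    by case: h => [|[F []]]; [left | right; exists F].
  apply: polyhedral_exists_fin => u; apply: polyhedral_and (@polyhedral_const R c I _) _.
  apply: polyhedral_or; first exact: polyhedral_le (affine0 _ _).
  apply: polyhedral_exists_fin => F; apply: polyhedral_and (@polyhedral_const R c I _) _.
  apply: polyhedral_and (@polyhedral_const R c I _) _.
  apply: polyhedral_le (affine1 _ _); apply: affine_add; exact: affine_sum.
have cov : polyhedral c (fun x => covered N (g^~ x)).
  apply: (@polyhedral_forall_fin _ c I {set V}) => F.
  case: (boolP (F \in N)) => FN; last first.
    by apply: polyhedral_iff (@polyhedral_const R c I True) => x; split.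
  apply: polyhedral_iff (polyhedral_le c (affine1 _ _) (affine_sum (index_enum V) (mem F) ag)) => x.
  by split=> [? _|/(_ isT)].
have le1 : polyhedral c (fun x => \sum_v (g v x - f v x) <= 1).
  apply: polyhedral_le (affine1 _ _); exact: affine_sum.
have ge1 : polyhedral c (fun x => 1 <= \sum_v (g v x - f v x)).
  apply: polyhedral_le (affine1 _ _) _; exact: affine_sum.
apply: polyhedral_iff (polyhedral_and (polyhedral_and inc play)
  (polyhedral_and le1 (polyhedral_or ge1 cov))) => x.
by split=> [[[? ?] [? ?]]|[]].
Qed.

Lemma move_rel_limit_closed t : limit_closed (move_rel N t).
Proof.
have := polyhedral_move_rel true (fun v => affine_var R (inl v : V + V))
  (fun v => affine_var R (inr v : V + V)).
move=> /polyhedral_limit_closed cl t' h.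
apply: (cl (joint t t')) => e /h[y ty yt']; exists (joint t y) => //.
by case=> v //=; rewrite subrr normr0 (le_trans _ (yt' v)).
Qed.

End MoveRelation.

(** * Values of positions *)

Section Values.
Variables (R : realType) (V : finType) (N : {set {set V}}).
Hypothesis N0 : set0 \notin N.
Implicit Types (t : V -> R) (p : player) (y z : R).

Definition better p y z := match p with EdgeHitter => y <= z | Staller => z <= y end.

(** The value with n rounds left and p to move, as a relation: this avoids
    infima and suprema before they are known to be attained, and shows that the
    relation is first-order. *)
Fixpoint is_value n p t y : Prop :=
  if n is n'.+1 then
    (exists2 t', move_rel N t t' & is_value n' (opponent p) t' y) /\
    (forall t' z, move_rel N t t' -> is_value n' (opponent p) t' z -> better p y z)
  else y = \sum_v t v.

Lemma value_unique n p t y z : is_value n p t y -> is_value n p t z -> y = z.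
Proof.
case: n => [|n] /=; first by move=> -> ->.
move=> [[t1 m1 v1] b1] [[t2 m2 v2] b2].
have := b1 _ _ m2 v2; have := b2 _ _ m1 v1.
by case: p {v1 v2 b1 b2} => /= ? ?; apply/eqP; rewrite eq_le; apply/andP.
Qed.

Lemma value_covered n p t y : covered N t -> is_value n p t y -> y = \sum_v t v.
Proof.
move=> ct; elim: n p => [|n IH] p //= [[t' /(move_rel_covered ct) -> /IH]] //.
Qed.

(** Existence and continuity depend on each other: the optimum is attained since
    the values with one round less are Lipschitz, and from a nearby position a
    nearby successor is available, which is as good up to a Lipschitz error. *)
Lemma value_exists_lipschitz n p :
  (forall t, in_cube t -> exists y, is_value n p t y) /\
  exists2 C : R, 0 <= C & forall s t y z e, in_cube s -> in_cube t ->
    0 <= e -> (forall v, `|s v - t v| <= e) ->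
    is_value n p s y -> is_value n p t z -> `|y - z| <= C * e.
Proof.
elim: n p => [|n IH] p.
  split=> [t _|]; first by exists (\sum_v t v).
  exists #|V|%:R; first exact: ler0n.
  move=> s t _ _ e _ _ e0 st -> ->; rewrite -sumrB.
  apply: le_trans (ler_norm_sum _ _ _) _; rewrite mulr_natl -sumr_const.
  exact: ler_sum.
have [ex [C C0 lip]] := IH (opponent p).
have /choice[f fP] : forall x, exists y, in_cube x -> is_value n (opponent p) x y.
  move=> x; case: (pselect (in_cube x)) => hx; last by exists 0.
  by have [y] := ex x hx; exists y.
have {}ex t : in_cube t -> exists y, is_value n.+1 p t y.
  (* the sign turns the maximization of Staller into a minimization *)
  move=> t01; pose sg : R := if p is EdgeHitter then 1 else -1.
  have K01 x : move_rel N t x -> in_cube x by move/move_rel_in_cube; exact.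
  have [|||||x tx xmin] := @cube_min R V (move_rel N t) (fun x => sg * f x) C.
  - exact: move_rel_exists.
  - exact: K01.
  - exact: move_rel_limit_closed.
  - exact: C0.
  - move=> x y e /K01 x01 /K01 y01 e0 xy; rewrite -mulrBr normrM.
    have -> : `|sg| = 1 by rewrite /sg; case: (p); rewrite ?normrN normr1.
    by rewrite mul1r; apply: (lip x y) => //; exact: fP.
  exists (f x); split; first by exists x => //; exact/fP/K01.
  move=> t' z tt' /value_unique/(_ (fP t' (K01 _ tt'))) ->.
  have := xmin _ tt'; rewrite /sg; case: (p) => /=; rewrite ?mul1r //.
  by rewrite !mulN1r lerN2.
split=> //; have [D D0 lipM] := move_rel_lipschitz R N0.
exists (C * D); first exact: mulr_ge0.
have half s t y z e : in_cube s -> in_cube t -> 0 <= e ->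
    (forall v, `|s v - t v| <= e) -> is_value n.+1 p s y -> is_value n.+1 p t z ->
    exists2 z', better p z z' & `|y - z'| <= C * D * e.
  move=> s01 t01 e0 st [[s' ss' vy] _] [_ zbest].
  have [t' tt' st'] := lipM _ _ _ _ e0 st ss'.
  have s'01 := move_rel_in_cube ss' s01; have t'01 := move_rel_in_cube tt' t01.
  exists (f t'); first exact: zbest tt' (fP _ t'01).
  rewrite -mulrA; apply: (lip s' t') => //; [exact: mulr_ge0 | exact: fP].
move=> s t y z e s01 t01 e0 st vy vz.
have [z' bz yz'] := half _ _ _ _ _ s01 t01 e0 st vy vz.
have ts v : `|t v - s v| <= e by rewrite distrC.
have [y' b_y zy'] := half _ _ _ _ _ t01 s01 e0 ts vz vy.
move: yz' zy' bz b_y; rewrite !ler_norml => /andP[? ?] /andP[? ?].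
by case: (p) => /= ? ?; apply/andP; split; lra.
Qed.

Lemma value_exists n p t : in_cube t -> exists y, is_value n p t y.
Proof. by case: (value_exists_lipschitz n p) => ex _; exact: ex. Qed.

(** Induction on n; a round adds one existential and one universal block of real
    quantifiers, the latter expressed by complements. *)
Lemma polyhedral_value n p (I : finType) (f : V -> (I -> R) -> R) (g : (I -> R) -> R) :
  (forall v, affine_fun (f v)) -> affine_fun g ->
  polyhedral false (fun x => is_value n p (f^~ x) (g x)).
Proof.
elim: n p I f g => [|n IH] p I f g af ag.
  have s1 := polyhedral_le false ag (affine_sum (index_enum V) xpredT af).
  have s2 := polyhedral_le false (affine_sum (index_enum V) xpredT af) ag.
  apply: polyhedral_iff (polyhedral_and s1 s2) => x /=.
  by split=> [/andP|->]; [rewrite -eq_le => /eqP | split].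
have lift (K : finType) (h : (I -> R) -> R) :
    affine_fun h -> affine_fun (fun w : I + K -> R => h (w \o inl)).
  by move=> ah; apply: affine_comp ah _ => i; exact: affine_var.
apply: polyhedral_and.
  have : polyhedral false (fun x => exists t', move_rel N (f^~ x) t' /\
      is_value n (opponent p) t' (g x)).
    apply: polyhedral_exists; apply: polyhedral_and.
      apply: (polyhedral_move_rel N false (fun v => lift V _ (af v))) => v.
      exact: affine_var.
    by apply: IH (lift V _ ag) => v; exact: affine_var.
  by apply: polyhedral_iff => x; split=> [[t' [? ?]]|[t' ? ?]]; exists t'.
have : polyhedral false (fun x => ~ exists w : option V -> R,
    (move_rel N (f^~ x) (w \o Some) /\ is_value n (opponent p) (w \o Some) (w None)) /\
    ~ better p (g x) (w None)).
  apply: polyhedral_not; apply: polyhedral_exists; apply: polyhedral_and.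
    apply: polyhedral_and.
      apply: (polyhedral_move_rel N false (fun v => lift _ _ (af v))) => v.
      exact: affine_var.
    by apply: IH => [v|]; exact: affine_var.
  apply: polyhedral_not.
  by case: (p); apply: polyhedral_le => //; solve [exact: lift | exact: affine_var].
apply: polyhedral_iff => x; split.
  move=> h t' z tt' vz; apply: contrapT => nb; apply: h.
  by exists (fun i => if i is Some v then t' v else z).
by move=> h [w [[tt' vz]]]; apply; exact: h tt' vz.
Qed.

Lemma value_rational n p t y : rational_valued t -> is_value n p t y ->
  exists q : rat, y = ratr q.
Proof.
move=> /choice[q tq] vy.
have at_t : polyhedral false (fun x : unit -> R => is_value n p t (x tt)).
  apply: (polyhedral_value n p (f := fun v _ => t v)); last exact: affine_var.
  by move=> v; rewrite tq; exact: affine_rat.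
have [q' vq'] := polyhedral_rational_point (x := fun=> y) at_t vy.
by exists (q' tt); exact: value_unique vy vq'.
Qed.

(** The optimal successors of a rational position form, together with the value,
    a nonempty polyhedral set, which has a rational point. *)
Lemma rational_optimal_move n p t y : is_value n.+1 p t y ->
  exists t', [/\ move_rel N t t', is_value n (opponent p) t' y &
    rational_valued t -> rational_valued t'].
Proof.
move=> vy; have [[t' tt' vt'] _] := vy.
case: (pselect (rational_valued t)) => [tr|ntr]; last by exists t'.
have /choice[q tq] := tr.
have at_t v : affine_fun (fun _ : option V -> R => t v) by rewrite tq; exact: affine_rat.
have best : polyhedral false (fun w : option V -> R =>
    (move_rel N t (w \o Some) /\ is_value n (opponent p) (w \o Some) (w None)) /\
    is_value n.+1 p t (w None)).
  apply: polyhedral_and; [apply: polyhedral_and|].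
  - by apply: (polyhedral_move_rel N false at_t) => v; exact: affine_var.
  - by apply: polyhedral_value => [v|]; exact: affine_var.
  - by apply: (polyhedral_value n.+1 p at_t); exact: affine_var.
have [] := polyhedral_rational_point
  (x := fun i => if i is Some v then t' v else y) best.
  by split.
move=> q' [[tt1 v1] v2]; exists (fun v => ratr (q' (Some v))); split=> //.
  by rewrite (value_unique vy v2).
by move=> _ v; exists (q' (Some v)).
Qed.

End Values.

(** * Optimal strategies *)

Section Game.
Variables (R : realType) (V : finType) (N : {set {set V}}).
Hypothesis N0 : set0 \notin N.
Variable first : player.
Implicit Types (p : player) (h : seq (game_move R V)) (sigma tau : strategy R V).

Lemma cover_rcons h (m : game_move R V) : cover (rcons h m) = apply_move (cover h) m.
Proof. by rewrite /cover foldl_rcons. Qed.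

Lemma to_moveS i : to_move first i.+1 = opponent (to_move first i).
Proof. by rewrite /to_move /=; case: (odd i); case: first. Qed.

Lemma play_in_cube p sigma h : play_with N first p sigma h -> in_cube (cover h).
Proof.
elim=> [v|h' m _ IH _ /legal_move_rel mr _]; first by rewrite /= lexx ler01.
by rewrite cover_rcons; exact: move_rel_in_cube mr IH.
Qed.

(** A move that does not end the game has weight exactly 1. *)
Lemma unfinished_weight p sigma h : play_with N first p sigma h ->
  ~ finished N (cover h) -> game_weight h = (size h)%:R.
Proof.
elim=> [_|h' m _ IH nf /legal_move_rel [_ _ le1 fin] _]; first by rewrite /game_weight /= big1.
rewrite /game_weight cover_rcons finishedE size_rcons => nc.
case: fin => // ge1; move: (IH nf) ge1 le1; rewrite sumrB /game_weight => ->.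
by rewrite -natr1; lra.
Qed.

Lemma unfinished_size p sigma h : play_with N first p sigma h ->
  ~ finished N (cover h) -> (size h <= #|V|)%N.
Proof.
move=> pl nf; rewrite -(ler_nat R) -(unfinished_weight pl nf) -sum1_card natr_sum.
by apply: ler_sum => v _; case/andP: (play_in_cube pl v).
Qed.

Lemma play_size p sigma h : play_with N first p sigma h -> (size h <= #|V|.+1)%N.
Proof. by case=> [|h' m pl nf _ _] //; rewrite size_rcons ltnS (unfinished_size pl). Qed.

(** Two legal strategies can be played against each other, and the game ends
    since an unfinished history has at most |V| moves. *)
Lemma play_both sigma tau :
  legal_strategy N first EdgeHitter sigma -> legal_strategy N first Staller tau ->
  exists h, [/\ play_with N first EdgeHitter sigma h,
    play_with N first Staller tau h & finished N (cover h)].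
Proof.
move=> lsigma ltau.
have [h [ps pt fin]] : exists h, [/\ play_with N first EdgeHitter sigma h,
    play_with N first Staller tau h & finished N (cover h) \/ size h = #|V|.+1].
  elim: #|V|.+1 => [|n [h [ps pt fin]]].
    by exists [::]; split; [exact: play_start | exact: play_start | right].
  case: (pselect (finished N (cover h))) => nf; first by exists h; split=> //; left.
  have {fin} sh : size h = n by case: fin.
  case e : (to_move first (size h)).
    exists (rcons h (sigma h)); split; last by right; rewrite size_rcons sh.
      by apply: play_move => //; exact: lsigma.
    by apply: play_move => //; [exact: lsigma | rewrite e].
  exists (rcons h (tau h)); split; last by right; rewrite size_rcons sh.
    by apply: play_move => //; [exact: ltau | rewrite e].
  by apply: play_move => //; exact: ltau.
exists h; split=> //; case: fin => // sh; apply: contrapT => nf.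
by have := unfinished_size ps nf; rewrite sh ltnn.
Qed.

Lemma ensures_le sigma tau a b : ensures N first EdgeHitter sigma a ->
  ensures N first Staller tau b -> b <= a.
Proof.
move=> [ls es] [lt et]; have [h [ps pt fin]] := play_both ls lt.
exact: le_trans (et h pt fin) (es h ps fin).
Qed.

Lemma game_value_eq sigma tau a : ensures N first EdgeHitter sigma a ->
  ensures N first Staller tau a -> game_value R N first = a.
Proof.
move=> es et; apply/eqP; rewrite eq_le /game_value; apply/andP; split.
  apply: ge_inf; last by exists sigma.
  by exists a => b [sigma' /ensures_le]; apply; exact: et.
apply: lb_le_inf; first by exists a, sigma.
by move=> b [sigma' /ensures_le]; apply; exact: et.
Qed.

(** The reply is optimal for whoever is to move, so a single strategy serves both
    players. The optimum refers to the rounds that are left out of |V| + 1. *)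
Lemma optimal_strategy_exists : exists sigma : strategy R V,
  forall h n y, (size h + n.+1 = #|V|.+1)%N ->
    is_value N n.+1 (to_move first (size h)) (cover h) y ->
    [/\ legal_move N (cover h) (sigma h), finitely_many_submoves (sigma h),
        is_value N n (opponent (to_move first (size h)))
          (apply_move (cover h) (sigma h)) y
      & rational_valued (cover h) -> rational_weights (sigma h)].
Proof.
have /choice[sigma sP] : forall h, exists m, forall n y,
    (size h + n.+1 = #|V|.+1)%N ->
    is_value N n.+1 (to_move first (size h)) (cover h) y ->
    [/\ legal_move N (cover h) m, finitely_many_submoves m,
        is_value N n (opponent (to_move first (size h))) (apply_move (cover h) m) y
      & rational_valued (cover h) -> rational_weights m].
  move=> h; set n0 := (#|V| - size h)%N.
  have nE n : (size h + n.+1 = #|V|.+1)%N -> n = n0.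
    by rewrite /n0 addnS => -[<-]; rewrite addKn.
  case: (pselect (exists y, is_value N n0.+1 (to_move first (size h)) (cover h) y)).
    move=> [y vy]; have [t' [tt' vt' tr]] := rational_optimal_move vy.
    have [m [ml mf mt mr]] := move_rel_legal tt'.
    exists m => n z /nE -> vz; rewrite (value_unique vz vy) mt; split=> // cr.
    by apply: mr => //; exact: tr.
  by move=> nv; exists (FiniteMove [::]) => n y /nE -> vy; case: nv; exists y.
by exists sigma.
Qed.

Lemma better_trans p (x y z : R) : better p x y -> better p y z -> better p x z.
Proof. by case: p => /= h1 h2; [exact: le_trans h2 | exact: le_trans h1]. Qed.

(** Along a play in which p follows the optimal strategy the value of the
    position never changes to the disadvantage of p: it is kept by the moves of
    p, and an arbitrary move of the opponent is at best optimal. At the end the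
    value is the weight of the game. *)
Theorem game_rational_optimum :
  [/\ exists q : rat, game_value R N first = ratr q,
      exists sigma : strategy R V,
        ensures N first EdgeHitter sigma (game_value R N first) /\
        finite_rational_strategy N first EdgeHitter sigma
    & exists sigma : strategy R V,
        ensures N first Staller sigma (game_value R N first) /\
        finite_rational_strategy N first Staller sigma].
Proof.
have zero01 : in_cube (fun _ : V => 0 : R) by move=> v; rewrite lexx ler01.
have [a va] := value_exists N0 #|V|.+1 first zero01.
have [sigma sP] := optimal_strategy_exists.
have reply p h : play_with N first p sigma h -> ~ finished N (cover h) -> exists n,
    (size h + n.+1 = #|V|.+1)%N.
  move=> pl nf; exists (#|V| - size h)%N.
  by rewrite addnS subnKC // (unfinished_size pl).
have legal p : legal_strategy N first p sigma.
  move=> h pl nf _; have [n hn] := reply p h pl nf.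
  have [y vy] := value_exists N0 n.+1 (to_move first (size h)) (play_in_cube pl).
  by have [] := sP _ _ _ hn vy.
have frs p : finite_rational_strategy N first p sigma.
  move=> h pl nf _; have [n hn] := reply p h pl nf.
  have [y vy] := value_exists N0 n.+1 (to_move first (size h)) (play_in_cube pl).
  by have [] := sP _ _ _ hn vy.
have invariant p h : play_with N first p sigma h -> forall n y,
    (size h + n = #|V|.+1)%N ->
    is_value N n (to_move first (size h)) (cover h) y -> better p y a.
  elim=> [n y /=|h' m pl IH nf lm fol n y]; rewrite ?add0n.
    by move=> -> vy; rewrite (value_unique (n := #|V|.+1) vy va); case: (p) => /=.
  rewrite size_rcons addSnnS cover_rcons to_moveS => hn vy.
  have [z vz] := value_exists N0 n.+1 (to_move first (size h')) (play_in_cube pl).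
  apply: better_trans (IH _ _ hn vz).
  case: (pselect (to_move first (size h') = p)) => [tm|tm].
    have [_ _ vz' _] := sP _ _ _ hn vz; rewrite -(fol tm) in vz'.
    by rewrite (value_unique vy vz'); case: (p) => /=.
  have [_ /(_ _ _ (legal_move_rel lm) vy)] := vz.
  by move: tm; case: (to_move _ _); case: (p).
have opt p : ensures N first p sigma a.
  split=> // h pl fin.
  have hn := subnKC (play_size pl).
  have [y vy] := value_exists N0 (#|V|.+1 - size h) (to_move first (size h)) (play_in_cube pl).
  have := invariant p h pl _ _ hn vy.
  by rewrite (value_covered (iffLR (finishedE _ _) fin) vy); case: (p).
rewrite (game_value_eq (opt EdgeHitter) (opt Staller)); split.
- by apply: value_rational va => v; exists 0; rewrite rmorph0.
- by exists sigma.
- by exists sigma.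
Qed.

End Game.

Theorem theorem15 (R : realType) (V : finType) (E : {set {set V}})
    (E_nonempty : set0 \notin E) :
  (forall first : player,
    let N := closed_nbhd_hypergraph E in
    [/\ exists q : rat, game_value R N first = ratr q,
        exists sigma : strategy R V,
          ensures N first EdgeHitter sigma (game_value R N first) /\
          finite_rational_strategy N first EdgeHitter sigma
      & exists sigma : strategy R V,
          ensures N first Staller sigma (game_value R N first) /\
          finite_rational_strategy N first Staller sigma])
  /\
  ((forall v : V, open_nbhd E v != set0) ->
   forall first : player,
    let N := open_nbhd_hypergraph E in
    [/\ exists q : rat, game_value R N first = ratr q,
        exists sigma : strategy R V,
          ensures N first EdgeHitter sigma (game_value R N first) /\
          finite_rational_strategy N first EdgeHitter sigma
      & exists sigma : strategy R V,
          ensures N first Staller sigma (game_value R N first) /\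
          finite_rational_strategy N first Staller sigma]).
Proof.
split=> [first|open_nonempty first] N; apply: game_rational_optimum.
  rewrite inE; apply/existsP => -[v /eqP N0].
  by have := setU11 v (open_nbhd E v); rewrite -/(closed_nbhd E v) -N0 inE.
by rewrite inE; apply/existsP => -[v /eqP N0]; have := open_nonempty v; rewrite -N0 eqxx.
Qed.
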